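(* Let $\zeta=e^{2\pi i/3}$, let $a=-2^{1/3}$ (the real number with $a^3=-2$), and let $m_1,\dots,m_{18}$ be the following $3\times 3$ complex matrices: $$m_1=\begin{pmatrix}1&-1&0\\-1&1&0\\0&0&0\end{pmatrix},\quad m_2=\begin{pmatrix}0&0&0\\0&1&-\zeta\\0&-\zeta^2&1\end{pmatrix},\quad m_3=\begin{pmatrix}1&0&-\zeta\\0&0&0\\-\zeta^2&0&1\end{pmatrix},$$ $$m_4=\begin{pmatrix}0&0&0\\0&1&-\zeta^2\\0&-\zeta&1\end{pmatrix},\quad m_5=\begin{pmatrix}1&0&-1\\0&0&0\\-1&0&1\end{pmatrix},\quad m_6=\begin{pmatrix}1&-\zeta&0\\-\zeta^2&1&0\\0&0&0\end{pmatrix},$$ $$m_7=\begin{pmatrix}1&0&-\zeta^2\\0&0&0\\-\zeta&0&1\end{pmatrix},\quad m_8=\begin{pmatrix}1&-\zeta^2&0\\-\zeta&1&0\\0&0&0\end{pmatrix},\quad m_9=\begin{pmatrix}0&0&0\\0&1&-1\\0&-1&1\end{pmatrix},$$ $$m_{10}=\begin{pmatrix}a&0&0\\0&a&0\\0&0&a\end{pmatrix},\quad m_{11}=\begin{pmatrix}0&1&0\\0&0&\zeta\\\zeta^2&0&0\end{pmatrix},\quad m_{12}=\begin{pmatrix}0&0&1\\\zeta^2&0&0\\0&\zeta&0\end{pmatrix},$$ $$m_{13}=\begin{pmatrix}0&1&0\\0&0&\zeta^2\\\zeta&0&0\end{pmatrix},\quad m_{14}=\begin{pmatrix}0&0&1\\1&0&0\\0&1&0\end{pmatrix},\quad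 m_{15}=\begin{pmatrix}1&0&0\\0&\zeta&0\\0&0&\zeta^2\end{pmatrix},$$ $$m_{16}=\begin{pmatrix}0&0&1\\\zeta&0&0\\0&\zeta^2&0\end{pmatrix},\quad m_{17}=\begin{pmatrix}1&0&0\\0&\zeta^2&0\\0&0&\zeta\end{pmatrix},\quad m_{18}=\begin{pmatrix}0&1&0\\0&0&1\\1&0&0\end{pmatrix}.$$ Let $S=\{m_1^{(3)},\dots,m_{18}^{(3)}\}\subset S^3(V^\ast\otimes V)$, where $V=\mathbb{C}^3$, and let $\Gamma_S$ be the subgroup of $\Gamma_{sM_{\langle 3\rangle}}=\mathrm{PGL}(V)\rtimes\mathbb{Z}_2$ consisting of the elements that leave the set $S$ invariant. Then $$\Gamma_S\cong(\mathbb{Z}_3^2\rtimes \mathrm{SL}(2,\mathbb{F}_3))\rtimes\mathbb{Z}_2,$$ which has order $432$. Here $\mathrm{SL}(2,\mathbb{F}_3)$ acts on $\mathbb{Z}_3^2=\mathbb{F}_3^2$ by linear transformations, the factor in parentheses is the subgroup $\Gamma_S\cap\mathrm{PGL}(V)$, and the factor $\mathbb{Z}_2$ is the subgroup generated by matrix transposition $X\mapsto X^{T}$.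
   Context: Let $V=\mathbb{C}^3$ and identify $V^\ast\otimes V$ with the space of $3\times3$ complex matrices. For a matrix $m$, $m^{(3)}=m\otimes m\otimes m\in S^3(V^\ast\otimes V)$ denotes its symmetric cube; $m^{(3)}=m'^{(3)}$ if and only if $m'=\zeta^k m$ for some integer $k$ (for nonzero $m$). A linear automorphism $\varphi$ of $V^\ast\otimes V$ acts on $S^3(V^\ast\otimes V)$ by the induced action, so that $\varphi\cdot m^{(3)}=\varphi(m)^{(3)}$; thus $\varphi$ leaves $S$ invariant exactly when it preserves $\{m_1,\dots,m_{18}\}$ up to multiplication of matrices by powers of $\zeta$. The symmetrized matrix multiplication tensor $sM_{\langle 3\rangle}\in S^3(V^\ast\otimes V)$ corresponds to the symmetric trilinear form $(A,B,C)\mapsto\frac12(\operatorname{tr}(ABC)+\operatorname{tr}(ACB))$. Its symmetry group is taken to be $\Gamma_{sM_{\langle 3\rangle}}=\mathrm{PGL}(V)\rtimes\mathbb{Z}_2$, the group of linear automorphisms of $V^\ast\otimes V$ of the form $X\mapsto gXg^{-1}$ or $X\mapsto gX^{T}g^{-1}$ with $g\in\mathrm{GL}(V)$; here $\mathrm{PGL}(V)$ is identified with the subgroup of conjugations $X\mapsto gXg^{-1}$ and $\mathbb{Z}_2$ is generated by matrix transposition in the standard basis. *)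

(* Defs.v *)
From HB Require Import structures.
From mathcomp Require Import all_boot all_order all_algebra all_fingroup.
From mathcomp Require Import all_solvable all_field all_character.
From mathcomp Require Import complex mxtens.
From mathcomp Require Import all_classical all_reals all_analysis.

Set Implicit Arguments.
Unset Strict Implicit.
Unset Printing Implicit Defensive.

Import Order.TTheory GRing.Theory Num.Theory.

Local Open Scope classical_set_scope.
Local Open Scope ring_scope.

Section Matrices.
Variable R : realType.

Definition zeta : R[i] := (cos (2 * pi / 3) +i* sin (2 * pi / 3))%C.

Definition alpha : R[i] := ((- (2 `^ 3^-1))%:C)%C.

Definition mx3 (rows : seq (seq R[i])) : 'M[R[i]]_3 :=
  \matrix_(i < 3, j < 3) nth 0 (nth [::] rows i) j.

Definition mats : seq 'M[R[i]]_3 :=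
  let z := zeta in
  let z2 := zeta ^+ 2 in
  let a := alpha in
  [:: mx3 [:: [:: 1; -1; 0]; [:: -1; 1; 0]; [:: 0; 0; 0]];
      mx3 [:: [:: 0; 0; 0]; [:: 0; 1; - z]; [:: 0; - z2; 1]];
      mx3 [:: [:: 1; 0; - z]; [:: 0; 0; 0]; [:: - z2; 0; 1]];

      mx3 [:: [:: 0; 0; 0]; [:: 0; 1; - z2]; [:: 0; - z; 1]];
      mx3 [:: [:: 1; 0; -1]; [:: 0; 0; 0]; [:: -1; 0; 1]];
      mx3 [:: [:: 1; - z; 0]; [:: - z2; 1; 0]; [:: 0; 0; 0]];

      mx3 [:: [:: 1; 0; - z2]; [:: 0; 0; 0]; [:: - z; 0; 1]];
      mx3 [:: [:: 1; - z2; 0]; [:: - z; 1; 0]; [:: 0; 0; 0]];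
      mx3 [:: [:: 0; 0; 0]; [:: 0; 1; -1]; [:: 0; -1; 1]];

      mx3 [:: [:: a; 0; 0]; [:: 0; a; 0]; [:: 0; 0; a]];
      mx3 [:: [:: 0; 1; 0]; [:: 0; 0; z]; [:: z2; 0; 0]];
      mx3 [:: [:: 0; 0; 1]; [:: z2; 0; 0]; [:: 0; z; 0]];

      mx3 [:: [:: 0; 1; 0]; [:: 0; 0; z2]; [:: z; 0; 0]];
      mx3 [:: [:: 0; 0; 1]; [:: 1; 0; 0]; [:: 0; 1; 0]];
      mx3 [:: [:: 1; 0; 0]; [:: 0; z; 0]; [:: 0; 0; z2]];

      mx3 [:: [:: 0; 0; 1]; [:: z; 0; 0]; [:: 0; z2; 0]];
      mx3 [:: [:: 1; 0; 0]; [:: 0; z2; 0]; [:: 0; 0; z]];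
      mx3 [:: [:: 0; 1; 0]; [:: 0; 0; 1]; [:: 1; 0; 0]]].

(* With W = V^* (x) V = 'M_3, the space S^3 W is viewed inside W (x) W (x) W:
   mxvec gives the coordinates of a matrix as a row vector, and the tensor
   product of coordinate vectors is the Kronecker product. *)
Definition tensor3 := 'M[R[i]]_(1 * 1 * 1, (3 * 3) * (3 * 3) * (3 * 3)).

Definition symcube (m : 'M[R[i]]_3) : tensor3 := mxvec m *t mxvec m *t mxvec m.

(* lin_mx f acts on coordinate row vectors from the right, so this is the
   action of f (x) f (x) f. *)
Definition tensor3_act (f : 'End('M[R[i]]_3)) (t : tensor3) : tensor3 :=
  t *m (lin_mx f *t lin_mx f *t lin_mx f).

Lemma tensor3_act_cube f m : tensor3_act f (symcube m) = symcube (f m).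
Proof. by rewrite /tensor3_act /symcube !tensmx_mul !mul_vec_lin. Qed.

Definition cubes : set tensor3 := [set symcube m | m in [set` mats]].

Definition PGL_conj : set 'End('M[R[i]]_3) :=
  [set f : 'End('M[R[i]]_3) |
    exists2 g, g \in unitmx & forall X, f X = g *m X *m invmx g].

Definition Gamma_sM : set 'End('M[R[i]]_3) :=
  PGL_conj `|`
  [set f : 'End('M[R[i]]_3) |
    exists2 g, g \in unitmx & forall X, f X = g *m X^T *m invmx g].

Definition Gamma_S : set 'End('M[R[i]]_3) :=
  [set f | Gamma_sM f /\ tensor3_act f @` cubes = cubes].

Definition trmx_lfun : 'End('M[R[i]]_3) := linfun (@trmx R[i] 3 3).

End Matrices.

Arguments PGL_conj : clear implicits.
Arguments Gamma_sM : clear implicits.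
Arguments Gamma_S : clear implicits.

Definition SL2F3_set : {set {'GL_2['F_3]}} := [set g | \det (val g) == 1]%SET.

Lemma SL2F3_group_set : group_set SL2F3_set.
Proof.
apply/group_setP; split=> [|x y]; rewrite !inE ?det1 //.
by rewrite det_mulmx => /eqP-> /eqP->; rewrite mulr1.
Qed.

Canonical SL2F3 : {group {'GL_2['F_3]}} := Group SL2F3_group_set.

(* The second argument of GLrepr is the size minus one. *)
Definition SL2F3_repr : mx_representation 'F_3 SL2F3 2 :=
  subg_repr (GLrepr 'F_3 1) (finset.subsetT SL2F3).

(* F_3^2 ><| SL(2, F_3): library actions are right actions, so SL(2, F_3) acts
   on row vectors by right multiplication. *)
Definition affSL2F3 : finGroupType := sdprod_by ('MR SL2F3_repr)%gact.

(* Main.v *)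
Require Import Defs.
From HB Require Import structures.
From mathcomp Require Import all_boot all_order all_algebra all_fingroup.
From mathcomp Require Import all_solvable all_field all_character.
From mathcomp Require Import complex mxtens.
From mathcomp Require Import all_classical all_reals all_analysis.
From mathcomp Require Import ring lra.

(* For p = (a, b) in F_3^2 let W_p be the Weyl operator X^a Z^b with the phase
   normalised so that W_p W_q = zeta^(-omega(p, q)) W_(p + q).  Up to powers of
   zeta, m_11, ..., m_18 are the W_p with p <> 0, and m_1, ..., m_9 are the
   matrices 1 - P_v with P_v = 1/3 sum_p zeta^(v p) W_p.  For det M = 1 the map
   W_p |-> zeta^(v p) W_(M p) preserves the structure constants, so it is an
   algebra automorphism of 'M_3, inner by Skolem-Noether; it permutes the P_v,
   and (M, v) |-> this map is a morphism from F_3^2 ><| SL(2, F_3).  Conversely,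
   a conjugation preserving the cubes preserves the traceless m_i up to phases,
   hence permutes the W_p projectively, and commutation relations force
   det M = 1.  Since W_p^T = W_(J p) with J = diag(-1, 1), transposition
   normalises this group, acting by (M, v) |-> (J M J, v J). *)

Set Implicit Arguments.
Unset Strict Implicit.
Unset Printing Implicit Defensive.

Import Order.TTheory GRing.Theory Num.Theory.

Local Open Scope ring_scope.

(** * Automorphisms of a full matrix algebra *)

(** Fix [w] with [f (E 0 0) *m w] nonzero and let column [i] of [g] be [f (E i 0) *m w]. Since
    [X *m E i 0] is the combination of the [E j 0] with coefficients from column [i] of [X],
    multiplicativity of [f] gives [f X *m g = g *m X]; it remains to see that [g] is invertible. *)
Lemma Skolem_Noether_matrix (C : fieldType) (n : nat)
    (f : 'End('M[C]_n.+1)) :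
    f 1%:M = 1%:M -> (forall X Y, f (X *m Y) = f X *m f Y) ->
  exists2 g, g \in unitmx & forall X, f X = g *m X *m invmx g.
Proof.
move=> f1 fM.
pose E i j : 'M[C]_n.+1 := delta_mx i j.
have Emul (X : 'M[C]_n.+1) i : X *m E i 0 = \sum_j X j i *: E j 0.
  apply/matrixP=> k l; rewrite mxE summxE (bigD1 i) //= big1 => [|j ji].
    rewrite (bigD1 k) //= big1 => [|j jk]; rewrite !mxE ?eqxx //=.
    by rewrite eq_sym (negPf jk) mulr0.
  by rewrite !mxE (negPf ji) mulr0.
have f00 : f (E 0 0) != 0.
  (* The identity is the sum of the [E i 0 *m E 0 0 *m E 0 i], so [f (E 0 0) = 0] would force
     [f 1%:M = 0]. *)
  apply/eqP=> f00; have := f1; suff -> : f 1%:M = 0.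
    by move/matrixP/(_ 0 0)/eqP; rewrite !mxE eq_sym oner_eq0.
  rewrite [X in f X](_ : _ = \sum_i E i 0 *m (E 0 0 *m E 0 i)).
    rewrite linear_sum big1 // => i _ /=.
    by rewrite fM fM f00 mul0mx mulmx0.
  rewrite mx1_sum_delta; apply: eq_bigr => i _.
  by rewrite !mul_delta_mx.
have [w fw] : exists w : 'cV_n.+1, f (E 0 0) *m w != 0.
  have /matrix0Pn[i [j fij]] := f00; exists (delta_mx j 0).
  by apply/matrix0Pn; exists i, 0; rewrite -colE mxE.
pose g := \sum_i f (E i 0) *m w *m delta_mx 0 i : 'M[C]_n.+1.
have fg X : f X *m g = g *m X.
  rewrite mulmx_sumr mulmx_suml.
  under eq_bigr => i _.
    rewrite !mulmxA -fM Emul linear_sum /= !mulmx_suml.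
    under eq_bigr => j _ do rewrite linearZ -!scalemxAl.
  over.
  rewrite exchange_big; apply: eq_bigr => j _.
  rewrite -!mulmxA -rowE [row j X]row_sum_delta !mulmx_sumr.
  by apply: eq_bigr => i _; rewrite -!scalemxAr !mulmxA mxE.
have g0 : g *m delta_mx 0 0 = f (E 0 0) *m w :> 'cV_n.+1.
  rewrite mulmx_suml (bigD1 0) //= big1 => [|i i0'].
    rewrite -[RHS]mulmx1 addr0 -(mulmxA (_ *m w)) mul_delta_mx.
    congr (_ *m _).
    by apply/matrixP=> i j; rewrite !ord1 !mxE.
  by rewrite -(mulmxA (_ *m w)) mul_delta_mx_0 // mulmx0.
have gU : g \in unitmx.
  rewrite -unitmx_tr -row_free_unit; apply: inj_row_free => v vg0.
  apply/rowP=> k; rewrite mxE; apply: contraNeq fw => vk.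
  have := congr1 trmx vg0; rewrite trmx_mul trmxK trmx0 => gv0.
  (* Applying [f (E 0 k)] isolates the entry [v 0 k] of a vector in the kernel of [g], because
     [f (E 0 k) *m g = g *m E 0 k]. *)
  have : f (E 0 k) *m (g *m v^T) = v 0 k *: (f (E 0 0) *m w).
    rewrite mulmxA fg -mulmxA -g0 scalemxAr; congr (_ *m _).
    apply/colP=> i; rewrite !mxE (bigD1 k) //= big1 => [|j jk].
      by rewrite !mxE !eqxx !andbT addr0 mulrC.
    by rewrite !mxE (negPf jk) andbF mul0r.
  by rewrite gv0 mulmx0 => /esym/eqP; rewrite scaler_eq0 (negPf vk).
by exists g => // X; rewrite -fg mulmxK.
Qed.

(** * Vectors and two-by-two matrices over F_3 *)

Lemma det_mx22 (K : comNzRingType) (M : 'M[K]_2) :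
  \det M = M 0 0 * M 1 1 - M 0 1 * M 1 0.
Proof.
have l0 : lift 0 0 = 1 :> 'I_2 by apply: val_inj.
have l1 : lift 1 0 = 0 :> 'I_2 by apply: val_inj.
rewrite (expand_det_row _ 0) !big_ord_recl big_ord0 addr0 /cofactor.
by rewrite !det_mx11 !mxE l0 l1 /= expr0 expr1 mul1r mulN1r mulrN.
Qed.

Lemma F3_ind (P : 'F_3 -> Prop) : P 0 -> P 1 -> P 2%:R -> forall x, P x.
Proof.
move=> P0 P1 P2 [[|[|[|//]]] h].
- by rewrite (_ : Ordinal h = 0) //; apply: val_inj.
- by rewrite (_ : Ordinal h = 1) //; apply: val_inj.
by rewrite (_ : Ordinal h = 2%:R) //; apply: val_inj.
Qed.

Lemma F3_double_eq0 (x : 'F_3) : (x + x == 0) = (x == 0).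
Proof. by case: x => -[|[|[|]]]. Qed.

Definition col2 (a b : 'F_3) : 'cV['F_3]_2 := \col_i (if i == 0 then a else b).

Lemma col2E (p : 'cV_2) : p = col2 (p 0 0) (p 1 0).
Proof.
apply/matrixP=> i j; rewrite ord1 mxE.
by case: i => -[|[|]] //= h; congr (p _ _); apply: val_inj.
Qed.

Lemma col2_neq0 (a b : 'F_3) : (a != 0) || (b != 0) -> col2 a b != 0.
Proof.
apply: contraL => /eqP/matrixP h; have := h 0 0; have := h 1 0.
by rewrite !mxE /= => -> ->.
Qed.

Lemma sum_col2 (V : nmodType) (F : 'cV['F_3]_2 -> V) :
  \sum_p F p = \sum_a \sum_b F (col2 a b).
Proof.
rewrite pair_big /= (reindex (fun ab : 'F_3 * 'F_3 => col2 ab.1 ab.2)) //=.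
exists (fun p => (p 0 0, p 1 0)) => [[a b] _|p _] /=; first by rewrite !mxE.
by rewrite -col2E.
Qed.

Definition row2 (a b : 'F_3) : 'rV['F_3]_2 := \row_i (if i == 0 then a else b).

Lemma row2E (v : 'rV_2) : v = row2 (v 0 0) (v 0 1).
Proof.
apply/matrixP=> i j; rewrite ord1 mxE.
by case: j => -[|[|]] //= h; congr (v _ _); apply: val_inj.
Qed.

Definition flipmx : 'M['F_3]_2 := diag_mx (\row_i (if i == 0 then -1 else 1)).

Lemma flip00 (p : 'cV_2) : (flipmx *m p) 0 0 = - p 0 0.
Proof. by rewrite mul_diag_mx !mxE mulN1r. Qed.

Lemma flip10 (p : 'cV_2) : (flipmx *m p) 1 0 = p 1 0.
Proof. by rewrite mul_diag_mx !mxE mul1r. Qed.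

Lemma flipmxK : flipmx *m flipmx = 1%:M.
Proof.
apply/matrixP=> i j; rewrite mul_diag_mx !mxE.
case: i j => [[|[|i]] hi] [[|[|j]] hj] //=.
all: by apply/eqP.
Qed.

Lemma det_flipmx : \det flipmx = -1.
Proof. by rewrite det_diag !big_ord_recl big_ord0 !mxE; apply: val_inj. Qed.

Lemma det_flip_conj M : \det M = 1 -> \det (flipmx *m M *m flipmx) = 1.
Proof. by move=> dM; rewrite !det_mulmx det_flipmx dM mulr1 mulrNN mulr1. Qed.

Lemma unitmx_mul_eq0 (M : 'M['F_3]_2) (p : 'cV_2) :
  M \in unitmx -> (M *m p == 0) = (p == 0).
Proof.
by move=> MU; apply/eqP/eqP => [h|->]; rewrite ?mulmx0 // -(mulKmx MU p) h mulmx0.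
Qed.

Lemma det1_unit (M : 'M['F_3]_2) : \det M = 1 -> M \in unitmx.
Proof. by move=> dM; rewrite unitmxE dM unitr1. Qed.

(** * Weyl operators over a field with a primitive cube root of unity *)

Section Weyl.
Variables (C : fieldType) (z : C).
Hypothesis z_prim : 3.-primitive_root z.

(** An additive character of F_3; the exponent is the representative 0, 1 or 2. *)
Definition chi (x : 'F_3) : C := z ^+ x.

Lemma chi0 : chi 0 = 1. Proof. by []. Qed.

Lemma chiD x y : chi (x + y) = chi x * chi y.
Proof. by rewrite /chi -exprD -[RHS](prim_expr_mod z_prim). Qed.

Lemma chi_inj : injective chi.
Proof.
move=> x y /eqP; rewrite (eq_prim_root_expr z_prim) !modn_small ?ltn_ord //.
by move/eqP/val_inj.
Qed.

Lemma chi_neq0 x : chi x != 0.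
Proof.
rewrite expf_neq0 //; apply/eqP=> z0; have := prim_expr_order z_prim.
by rewrite z0 expr0n => /eqP; rewrite eq_sym oner_eq0.
Qed.

Lemma chi_cube x : chi x ^+ 3 = 1.
Proof. by rewrite exprAC (prim_expr_order z_prim) expr1n. Qed.

(** Orthogonality of characters: a translation of [y] multiplies the sum by a value of [chi], which
    can be chosen different from 1 when [x] is nonzero. *)
Lemma sum_chi_mul (x : 'F_3) :
  \sum_(y : 'F_3) chi (x * y) = if x == 0 then 3%:R else 0.
Proof.
case: eqVneq => [->|x0].
  by under eq_bigr => y _ do rewrite mul0r; rewrite sumr_const card_Fp.
have [y xy1] : exists y, chi (x * y) != 1.
  by exists 1; rewrite mulr1 -chi0; apply: contraNneq x0 => /chi_inj ->.
apply: (mulfI (x := chi (x * y) - 1)); first by rewrite subr_eq0.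
rewrite mulr0 mulrBl mul1r [X in _ - X](reindex_inj (addrI y)) /=.
under [X in _ - X]eq_bigr => i _ do rewrite mulrDr chiD.
by rewrite -mulr_sumr subrr.
Qed.

(* Weighting by - b (i + j), that is, by b (i + j) / 2, is the choice of phase that
   makes transposition act on the index p without any scalar. *)
Definition weyl_entry (p : 'cV['F_3]_2) (i j : 'F_3) : C :=
  if j - i == p 0 0 then chi (- p 1 0 * (i + j)) else 0.

(** Row and column indices are read as elements of ['F_3], which is convertible to ['I_3]. *)
Definition weyl p : 'M[C]_3 := \matrix_(i, j) weyl_entry p i j.

Definition symp (p q : 'cV['F_3]_2) : 'F_3 := p 0 0 * q 1 0 - p 1 0 * q 0 0.

(** In each entry only the inner index [j = i + a] survives, with [a] the first coordinate of [p];
    the exponents on the two sides then agree as polynomials. *)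
Lemma weyl_mul p q : weyl p *m weyl q = chi (- symp p q) *: weyl (p + q).
Proof.
apply/matrixP=> i k; rewrite !mxE.
under eq_bigr => j _ do rewrite !mxE /weyl_entry.
rewrite /weyl_entry !mxE /symp.
move: (p 0 0) (p 1 0) (q 0 0) (q 1 0) => a b c d.
have -> : \sum_(j < 3) (if (j - i : 'F_3) == a then chi (- b * (i + j : 'F_3)) else 0) *
     (if (k - j : 'F_3) == c then chi (- d * (j + k : 'F_3)) else 0) =
  \sum_(j : 'F_3) if j == i + a then (chi (- b * (i + j : 'F_3)) *
     (if (k - j : 'F_3) == c then chi (- d * (j + k : 'F_3)) else 0)) else 0.
  by apply: eq_bigr => j _; rewrite subr_eq addrC; case: ifP; rewrite ?mul0r.
rewrite -big_mkcond big_pred1_eq.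
rewrite [k - i == _](_ : _ = (k - (i + a : 'F_3) == c)); last first.
  by rewrite opprD addrA [RHS]subr_eq [c + a]addrC.
case: eqP => [kE|]; last by rewrite !mulr0.
have -> : (k : 'F_3) = c + (i + a) by rewrite -kE subrK.
by rewrite -!chiD; congr chi; ring.
Qed.

Lemma weyl0 : weyl 0 = 1%:M.
Proof.
apply/matrixP=> i j; rewrite !mxE /weyl_entry !mxE oppr0 mul0r subr_eq0 eq_sym.
by case: eqP.
Qed.

Lemma mxtrace_weyl p : \tr (weyl p) = if p == 0 then 3%:R else 0.
Proof.
have -> : (p == 0) = (p 0 0 == 0) && (p 1 0 == 0).
  apply/eqP/andP => [->|[/eqP p0 /eqP p1]]; first by rewrite !mxE.
  by rewrite [p]col2E p0 p1; apply/colP=> i; rewrite !mxE; case: ifP.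
transitivity (\sum_(i : 'F_3) weyl_entry p i i).
  by apply: eq_bigr => i _; rewrite mxE.
rewrite /weyl_entry; under eq_bigr => i _ do rewrite subrr eq_sym.
case: eqP => [p0|p0] /=; last by rewrite big1.
(* The diagonal exponents are [- p 1 0 * (i + i)], so the character being summed is that of
   [- p 1 0] doubled, which vanishes only with [p 1 0]. *)
rewrite -[p 1 0 == 0]oppr_eq0 -F3_double_eq0 -sum_chi_mul; apply: eq_bigr => i _.
by rewrite mulrDl mulrDr.
Qed.

Lemma three_neq0 : 3%:R != 0 :> C.
Proof. exact: (prim_root_natf_neq0 z_prim). Qed.

(** Expansion in the basis of Weyl operators, which is orthogonal for the trace pairing of
    [weyl (- p)] with [weyl q]. *)
Lemma weyl_span X : X = 3%:R^-1 *: \sum_p \tr (weyl (- p) *m X) *: weyl p.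
Proof.
apply: (scalerI three_neq0); rewrite scalerA divff ?three_neq0 // scale1r.
apply/matrixP=> k l; rewrite summxE !mxE.
under eq_bigr => p _.
  rewrite !mxE /mxtrace mulr_suml.
  under eq_bigr => i _.
    rewrite !mxE mulr_suml.
    under eq_bigr => j _ do rewrite mxE mulrAC.
  over.
over.
rewrite exchange_big /=; under eq_bigr do rewrite exchange_big /=.
(* Completeness relation. Summing over the second coordinate of [p] forces [i + j = k + l], and the
   first coordinate forces [j - i = k - l]; as 2 is invertible in F_3, this means [j = k] and
   [i = l]. *)
have sumW (i j : 'I_3) : \sum_p weyl_entry (- p) i j * weyl_entry p k l * X j i =
   if (j == k) && (i == l) then 3%:R * X k l else 0.
  rewrite -mulr_suml sum_col2.
  transitivity (X j i * \sum_(a : 'F_3) if a == (l : 'F_3) - k then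
      if (j : 'F_3) - i == - a then
        \sum_b chi (((i : 'F_3) + j - (k + l : 'F_3)) * b) else 0 else 0).
    rewrite mulrC; congr (_ * _); apply: eq_bigr => a _.
    under eq_bigr => b _ do rewrite /weyl_entry !mxE /= (eq_sym _ a).
    case: ifP => _; last by rewrite big1 // => b _; rewrite mulr0.
    case: ifP => _; last by rewrite big1 // => b _; rewrite mul0r.
    by apply: eq_bigr => b _; rewrite -chiD; congr chi; ring.
  rewrite -big_mkcond big_pred1_eq sum_chi_mul.
  have hjk : (j == k) && (i == l) =
      ((j : 'F_3) - i == - ((l : 'F_3) - k))
        && ((i : 'F_3) + j - (k + l : 'F_3) == 0).
    apply/andP/andP => [[/eqP-> /eqP->]|[/eqP h1 /eqP h2]].
      by rewrite opprB subr_eq0 [_ + k]addrC !eqxx.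
    have jk : (j : 'F_3) = k.
      apply/eqP; rewrite -subr_eq0 -F3_double_eq0; apply/eqP.
      transitivity ((j : 'F_3) - i + ((l : 'F_3) - k)
        + ((i : 'F_3) + j - (k + l : 'F_3))); first by ring.
      by rewrite h1 h2 addr0 addNr.
    rewrite jk eqxx; split=> //; apply/eqP.
    have : (i : 'F_3) - l = 0 by rewrite -h2 jk; ring.
    by move/eqP; rewrite subr_eq0 => /eqP.
  case: (boolP ((j == k) && (i == l))) hjk
    => [/andP[/eqP -> /eqP ->] /esym/andP[-> ->]|_ /esym].
    by rewrite mulrC.
  by case: (_ == - _) => //= [->|]; rewrite mulr0.
rewrite (bigD1 l) //= [X in _ + X]big1 => [|i il]; last first.
  by rewrite big1 // => j _; rewrite sumW (negPf il) andbF.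
rewrite addr0 (bigD1 k) //= [X in _ + X]big1 => [|j jk].
  by rewrite sumW !eqxx addr0.
by rewrite sumW (negPf jk).
Qed.

Lemma weyl_ext (V : lmodType C) (f g : {linear 'M[C]_3 -> V}) :
  (forall p, f (weyl p) = g (weyl p)) -> f =1 g.
Proof.
move=> fg X; rewrite [X]weyl_span !linearZ !linear_sum /=.
by congr (_ *: _); apply: eq_bigr => p _; rewrite !linearZ fg.
Qed.

Lemma sympNp p : symp (- p) p = 0.
Proof. by rewrite /symp !mxE; ring. Qed.

(** Multiplying by [weyl (- p)] and taking traces leaves [3 * c] on the left, and on the right
    [3 * d] if [p = q] and 0 otherwise. *)
Lemma weyl_inj c d p q : c != 0 -> c *: weyl p = d *: weyl q -> p = q /\ c = d.
Proof.
move=> c0 /(congr1 (mulmx (weyl (- p)))) /(congr1 mxtrace).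
rewrite -!scalemxAr !weyl_mul !mxtraceZ !mxtrace_weyl addNr eqxx addrC subr_eq0.
rewrite sympNp oppr0 chi0 mul1r; case: eqP => [->|_ /eqP].
  by rewrite sympNp oppr0 chi0 mul1r => /(mulIf three_neq0).
by rewrite !mulr0 mulf_eq0 (negPf c0) (negPf three_neq0).
Qed.

(** Exchanging the indices negates the displacement [j - i] and fixes the phase, which depends on
    [i + j] only. *)
Lemma trmx_weyl p : (weyl p)^T = weyl (flipmx *m p).
Proof.
apply/matrixP=> i j; rewrite !mxE /weyl_entry flip00 flip10.
by rewrite -eqr_oppLR opprB [(j : 'F_3) + i]addrC.
Qed.

(** * Clifford maps: affine relabelings of the Weyl basis *)

(** The expansion of [weyl_span] with each [weyl p] replaced by its prescribed image. *)
Definition clifford_fun (M : 'M['F_3]_2) (v : 'rV['F_3]_2) (X : 'M[C]_3) : 'M[C]_3 :=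
  3%:R^-1 *: \sum_p \tr (weyl (- p) *m X) *: (chi ((v *m p) 0 0) *: weyl (M *m p)).

Lemma clifford_fun_is_linear M v : linear (clifford_fun M v).
Proof.
move=> a X Y; rewrite /clifford_fun [in RHS]scalerA mulrC -[in RHS]scalerA -scalerDr.
congr (_ *: _); rewrite scaler_sumr -big_split; apply: eq_bigr => p _.
rewrite mulmxDr mxtraceD -scalemxAr mxtraceZ [LHS]scalerDl; congr (_ + _).
by rewrite -[LHS]scalerA.
Qed.

HB.instance Definition _ M v := GRing.isLinear.Build C 'M[C]_3 'M[C]_3 _
  (clifford_fun M v) (clifford_fun_is_linear M v).

Lemma clifford_subproof (M : 'M['F_3]_2) (v : 'rV['F_3]_2) : {f : 'End('M[C]_3) |
  forall q, f (weyl q) = chi ((v *m q) 0 0) *: weyl (M *m q)}.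
Proof.
exists (linfun (clifford_fun M v)) => q.
rewrite lfunE /= /clifford_fun (bigD1 q) //= big1 => [|p pq].
  rewrite weyl_mul addNr mxtraceZ mxtrace_weyl eqxx addr0.
  by rewrite sympNp oppr0 chi0 mul1r [LHS]scalerA mulVf ?three_neq0 // scale1r.
rewrite weyl_mul mxtraceZ mxtrace_weyl addrC subr_eq0 eq_sym (negPf pq) mulr0.
by rewrite scale0r.
Qed.

(* The witness is kept opaque: unification would otherwise unfold it. *)
Definition clifford M v : 'End('M[C]_3) := sval (clifford_subproof M v).

Lemma clifford_weyl M v q :
  clifford M v (weyl q) = chi ((v *m q) 0 0) *: weyl (M *m q).
Proof. exact: (svalP (clifford_subproof M v)). Qed.

(** The resulting law on pairs is that of the semidirect product for right multiplication on row
    vectors, as in [aff_vecM]. *)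
Lemma clifford_comp M v M' v' :
  (clifford M v \o clifford M' v')%VF = clifford (M *m M') (v *m M' + v').
Proof.
have E p : clifford M v (clifford M' v' (weyl p)) =
    clifford (M *m M') (v *m M' + v') (weyl p).
  transitivity (clifford M v (chi ((v' *m p) 0 0) *: weyl (M' *m p))).
    by congr (clifford M v _); exact: clifford_weyl.
  rewrite [LHS]linearZ /= [in LHS](clifford_weyl M v).
  rewrite [RHS](clifford_weyl (M *m M')) scalerA -chiD.
  by rewrite [in RHS]mulmxDl [in RHS]mxE addrC !mulmxA.
by apply/lfunP; apply: weyl_ext => p; exact: etrans (comp_lfunE _ _ _) (E p).
Qed.

Lemma clifford1 : clifford 1%:M 0 = \1%VF.
Proof.
apply/lfunP => X; apply: (weyl_ext (g := \1%VF)) => p /=.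
by rewrite clifford_weyl id_lfunE mul0mx mxE mul1mx scale1r.
Qed.

Lemma symp_mulmx (M : 'M['F_3]_2) p q : symp (M *m p) (M *m q) = \det M * symp p q.
Proof.
rewrite /symp det_mx22 !mxE !big_ord_recl !big_ord0 !addr0 /=.
rewrite (_ : lift 0 0 = 1 :> 'I_2); last exact: val_inj.
by ring.
Qed.

(** By bilinearity, two uses of [weyl_ext] reduce to Weyl operators, whose structure constants
    depend on [symp] alone; determinant 1 preserves [symp]. *)
Lemma clifford_mulmx M v X Y : \det M = 1 ->
  clifford M v (X *m Y) = clifford M v X *m clifford M v Y.
Proof.
move=> dM; pose f := clifford M v.
apply: (weyl_ext (f := f \o mulmxr Y) (g := mulmxr (f Y) \o f)) => p /=.
apply: (weyl_ext (f := f \o mulmx (weyl p)) (g := mulmx (f (weyl p)) \o f)) => q /=.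
rewrite weyl_mul linearZ /= !clifford_weyl -scalemxAl -scalemxAr weyl_mul !scalerA.
rewrite symp_mulmx dM mul1r !mulmxDr [X in _ * chi X]mxE chiD.
by congr (_ *: _); ring.
Qed.

Lemma weyl_comm p q : weyl p *m weyl q = chi (symp p q) *: (weyl q *m weyl p).
Proof.
rewrite !weyl_mul scalerA -chiD [q + p]addrC; congr (chi _ *: _).
have -> : symp q p = - symp p q by rewrite /symp; ring.
(* What remains is [- s = s + s], valid in characteristic 3. *)
by move: (symp p q); apply: F3_ind; apply/eqP.
Qed.

(** The two Weyl operators generate the algebra up to phases, so [f] is determined by their images:
    [M] has columns [u] and [v], and [w] records the phases [k] and [l]. *)
Lemma clifford_of_generators (f : 'End('M[C]_3)) k l u v :
    f 1%:M = 1%:M -> (forall X Y, f (X *m Y) = f X *m f Y) ->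
    f (weyl (col2 1 0)) = chi k *: weyl u ->
    f (weyl (col2 0 1)) = chi l *: weyl v ->
  exists M w, \det M = 1 /\ f = clifford M w.
Proof.
move=> f1 fM fu fv.
pose M : 'M['F_3]_2 := \matrix_(i, j) (if j == 0 then u i 0 else v i 0).
pose w : 'rV['F_3]_2 := \row_i (if i == 0 then k else l).
have ME a b : M *m col2 a b = a *: u + b *: v.
  apply/colP=> i; rewrite !mxE !big_ord_recl big_ord0 !mxE /= addr0.
  by rewrite ![_ * u _ _]mulrC ![_ * v _ _]mulrC.
have wE a b : (w *m col2 a b) 0 0 = k * a + l * b.
  by rewrite !mxE !big_ord_recl big_ord0 !mxE /= addr0.
have dM : \det M = 1.
  (* Applying [f] to the commutation relation of the generators and cancelling the common phases
     gives [symp u v = 1], and [symp u v] is the determinant of [M]. *)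
  have := congr1 f (weyl_comm (col2 1 0) (col2 0 1)).
  rewrite linearZ /= !fM fu fv -!scalemxAl -!scalemxAr (weyl_comm u v) !scalerA.
  rewrite weyl_mul !scalerA => /weyl_inj[|_].
    by rewrite !mulf_neq0 ?chi_neq0.
  rewrite -!chiD => /chi_inj.
  move: (- symp v u) => x h.
  have : symp u v = symp (col2 1 0) (col2 0 1).
    transitivity (k + l + symp u v + x - (k + l + x)); first by ring.
    by rewrite h; ring.
  rewrite /symp !mxE /= => suv; rewrite det_mx22 !mxE /= [v 0 0 * _]mulrC suv.
  by rewrite mulr1 mulr0 subr0.
exists M, w; split=> //; pose g := clifford M w.
have gE a b : g (weyl (col2 a b)) = chi (k * a + l * b) *: weyl (a *: u + b *: v).
  by rewrite clifford_weyl wE ME.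
have fgD p q : f (weyl p) = g (weyl p) -> f (weyl q) = g (weyl q) ->
    f (weyl (p + q)) = g (weyl (p + q)).
  move=> fp fq; apply: (scalerI (chi_neq0 (- symp p q))).
  by rewrite -!linearZ /= -weyl_mul fM clifford_mulmx // fp fq.
have fg0 : f (weyl 0) = g (weyl 0).
  by rewrite clifford_weyl !mulmx0 mxE chi0 scale1r !weyl0.
have fgM p n : f (weyl p) = g (weyl p) -> f (weyl (p *+ n)) = g (weyl (p *+ n)).
  by move=> fp; elim: n => [|n IHn]; rewrite ?mulr0n // mulrS; apply: fgD.
apply/lfunP => X; apply: weyl_ext => p.
rewrite [p](_ : _ = col2 1 0 *+ p 0 0 + col2 0 1 *+ p 1 0).
  apply: fgD; apply: fgM.
    by rewrite gE fu mulr1 mulr0 addr0 scale1r scale0r addr0.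
  by rewrite gE fv mulr1 mulr0 add0r scale1r scale0r add0r.
rewrite [LHS]col2E; apply/colP=> i; rewrite !mxE !mulmxnE !mxE.
by case: ifP; rewrite mul0rn ?addr0 ?add0r natr_Zp.
Qed.

(* The displaced parity operators: reflections of the index set, with 1 - parity v
   of rank one. *)
Definition parity (v : 'rV['F_3]_2) : 'M[C]_3 :=
  3%:R^-1 *: \sum_p chi ((v *m p) 0 0) *: weyl p.

(** The phases add up to [(v + w) *m p]; substituting [M *m p] as the summation index moves
    [invmx M] onto the row vector. *)
Lemma clifford_parity M w v : M \in unitmx ->
  clifford M w (parity v) = parity ((v + w) *m invmx M).
Proof.
move=> MU; rewrite /parity linearZ linear_sum; congr (_ *: _) => /=.
rewrite [RHS](reindex_inj (can_inj (mulKmx MU))) /=; apply: eq_bigr => p _.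
rewrite linearZ /= clifford_weyl scalerA -chiD -!mulmxA mulKmx //.
by rewrite mulmxDl [in RHS]mxE.
Qed.

Lemma trmx_parity v : (parity v)^T = parity (v *m flipmx).
Proof.
rewrite /parity linearZ linear_sum; congr (_ *: _) => /=.
have fU : flipmx \in unitmx by case/mulmx1_unit: flipmxK.
rewrite [RHS](reindex_inj (can_inj (mulKmx fU))) /=; apply: eq_bigr => p _.
by rewrite linearZ /= trmx_weyl -mulmxA [flipmx *m (flipmx *m _)]mulmxA flipmxK mul1mx.
Qed.

Lemma mxtrace_parity v : \tr (parity v) = 1.
Proof.
rewrite /parity mxtraceZ raddf_sum /= (bigD1 0) //= big1 => [|p p0].
  by rewrite mulmx0 mxE chi0 scale1r mxtrace_weyl eqxx addr0 mulVf ?three_neq0.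
by rewrite mxtraceZ mxtrace_weyl (negPf p0) mulr0.
Qed.

(** Summing over the second coordinate leaves a delta at [i + j = b]: the reflection sending [i] to
    [b - i], twisted by phases. This form is compared with the first nine matrices. *)
Lemma parityE a b : parity (row2 a b) =
  \matrix_(i, j) (if b == (i : 'F_3) + j then chi (a * ((j : 'F_3) - i)) else 0).
Proof.
apply/matrixP=> i j; rewrite !mxE summxE sum_col2.
transitivity (3%:R^-1 * \sum_(c : 'F_3) if c == (j : 'F_3) - i then
   chi (a * c) * \sum_d chi ((b - ((i : 'F_3) + j)) * d) else 0).
  congr (_ * _); apply: eq_bigr => c _.
  under eq_bigr => d _.
    rewrite !mxE !big_ord_recl big_ord0 !mxE /weyl_entry !mxE /= addr0 eq_sym.
  over.
  case: ifP => _; last by rewrite big1 // => d _; rewrite mulr0.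
  by rewrite mulr_sumr; apply: eq_bigr => d _; rewrite -!chiD; congr chi; ring.
rewrite -big_mkcond big_pred1_eq sum_chi_mul subr_eq0.
by case: eqP => _; rewrite ?mulr0 // mulrC mulfK ?three_neq0.
Qed.

End Weyl.

(** * The affine group over SL(2, F_3) and its automorphism given by conjugation with [flipmx] *)

Lemma flipmx_unit : flipmx \is a GRing.unit.
Proof. by case/mulmx1_unit: flipmxK. Qed.

Lemma GL2_of_unitmx (M : 'M['F_3]_2) :
  M \is a GRing.unit -> {g : {'GL_2['F_3]} | val g = M}.
Proof. by move=> MU; exists (FinRing.unit _ MU). Qed.

(** Extracted from an opaque lemma, so that it is handled only through [val_flipGL]. *)
Definition flipGL : {'GL_2['F_3]} := sval (GL2_of_unitmx flipmx_unit).

Lemma val_flipGL : val flipGL = flipmx.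
Proof. exact: (svalP (GL2_of_unitmx flipmx_unit)). Qed.

Lemma flipGL_sq : (flipGL * flipGL = 1)%g.
Proof.
apply: val_inj; apply: etrans flipmxK; rewrite -val_flipGL.
exact: erefl.
Qed.

Lemma val_flipJ (g : {'GL_2['F_3]}) : val (g ^ flipGL)%g = flipmx *m val g *m flipmx.
Proof.
have flipV : (flipGL^-1 = flipGL)%g.
  by apply: (mulgI flipGL); rewrite mulgV flipGL_sq.
by rewrite conjgE flipV mulgA -val_flipGL.
Qed.

Lemma SL2F3_flipJ g : g \in SL2F3 -> (g ^ flipGL)%g \in SL2F3.
Proof. by rewrite !inE => /eqP dg; rewrite val_flipJ det_flip_conj. Qed.

Definition aff_mx (x : affSL2F3) : 'M['F_3]_2 := val x.1.
Definition aff_vec (x : affSL2F3) : 'rV['F_3]_2 := x.2.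

Lemma aff_inj x y : aff_mx x = aff_mx y -> aff_vec x = aff_vec y -> x = y.
Proof.
move=> /val_inj xy1 xy2; apply: val_inj => /=.
by rewrite [LHS]surjective_pairing [RHS]surjective_pairing xy1; congr pair.
Qed.

Lemma aff_fst_SL (x : affSL2F3) : x.1 \in SL2F3.
Proof. by case: x => [[g v] /= /setXP[]]. Qed.

Lemma det_aff_mx x : \det (aff_mx x) = 1.
Proof. by apply/eqP; have := aff_fst_SL x; rewrite inE. Qed.

Lemma aff_mxM x y : aff_mx (x * y)%g = aff_mx x *m aff_mx y.
Proof. by []. Qed.

Lemma aff_vecM x y : aff_vec (x * y)%g = aff_vec x *m aff_mx y + aff_vec y.
Proof.
rewrite {1}/aff_vec /=; congr (_ + _).
by rewrite mx_repr_actE ?aff_fst_SL.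
Qed.

Lemma aff_exists M v : \det M = 1 -> exists x, aff_mx x = M /\ aff_vec x = v.
Proof.
move=> dM; have [g gM] := GL2_of_unitmx (det1_unit dM : M \is a GRing.unit).
have xP : (g, v) \in finset.setX SL2F3 [set: 'rV['F_3]_2]%G.
  by apply/finset.setXP; split; rewrite inE ?gM ?dM ?eqxx.
by exists (SdPair _ xP); split; [exact: gM|].
Qed.

Lemma flip_aff_subproof (x : affSL2F3) :
  ((x.1 ^ flipGL)%g, aff_vec x *m flipmx) \in finset.setX SL2F3 [set: 'rV['F_3]_2]%G.
Proof. by rewrite inE SL2F3_flipJ ?aff_fst_SL ?inE. Qed.

Definition flip_aff (x : affSL2F3) : affSL2F3 := SdPair _ (flip_aff_subproof x).

Lemma flip_aff_mx x : aff_mx (flip_aff x) = flipmx *m aff_mx x *m flipmx.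
Proof. exact: val_flipJ. Qed.

Lemma flip_aff_vec x : aff_vec (flip_aff x) = aff_vec x *m flipmx.
Proof. by []. Qed.

Lemma flip_affK : involutive flip_aff.
Proof.
move=> x; apply: aff_inj.
  by rewrite !flip_aff_mx -!mulmxA flipmxK mulmx1 !mulmxA flipmxK mul1mx.
by rewrite !flip_aff_vec -mulmxA flipmxK mulmx1.
Qed.

Lemma flip_affM : {morph flip_aff : x y / (x * y)%g}.
Proof.
move=> x y; apply: aff_inj.
  rewrite aff_mxM !flip_aff_mx aff_mxM -!mulmxA.
  by rewrite [flipmx *m (flipmx *m _)]mulmxA flipmxK mul1mx.
rewrite aff_vecM !flip_aff_vec flip_aff_mx aff_vecM mulmxDl -!mulmxA.
by rewrite [flipmx *m (flipmx *m _)]mulmxA flipmxK mul1mx.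
Qed.

Definition flip_act (x : affSL2F3) (k : 'Z_2) := if k == 0 then x else flip_aff x.

Lemma Z2_ind (P : 'Z_2 -> Prop) : P 0 -> P 1 -> forall k, P k.
Proof.
move=> P0 P1 [[|[|//]] h].
- by rewrite (_ : Ordinal h = 0) //; apply: val_inj.
by rewrite (_ : Ordinal h = 1) //; apply: val_inj.
Qed.

Lemma flip_is_action : is_action [set: 'Z_2]%G flip_act.
Proof.
split=> [a x y|x a b _ _].
  move: a; apply: Z2_ind; first by move=> h; exact: h.
  by move=> h; apply: (can_inj flip_affK).
have z11 : 1 + 1 = 0 :> 'Z_2 by apply: val_inj.
move: a b; apply: Z2_ind; apply: Z2_ind; rewrite FinRing.zmodMgE ?addr0 ?add0r ?z11 //.
by apply/esym; apply: flip_affK.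
Qed.

Definition flip_action := Action flip_is_action.

Lemma flip_is_groupAction : is_groupAction [set: affSL2F3]%G flip_action.
Proof.
move=> a _; rewrite inE; apply/andP; split.
  by apply/fintype.subsetP=> x _; rewrite inE.
apply/morphicP=> x y _ _; rewrite !actpermE /=.
by move: a; apply: Z2_ind => //=; apply: flip_affM.
Qed.

Definition theta := GroupAction flip_is_groupAction.

(** * Orders of the groups *)

Lemma card_sdprod_by (aT rT : finGroupType) (D : {group aT}) (K : {group rT})
  (to : groupAction D K) : #|sdprod_by to| = (#|K| * #|D|)%N.
Proof.
rewrite -cardsT -(sdprod_card (sdprod_sdpair to)).
by rewrite !card_injm ?injm_sdpair1 ?injm_sdpair2.
Qed.

(** Determinants in GL(2, F_3) are 1 or -1, and right multiplication by [flipGL], of determinant -1,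
    exchanges the two classes; each is half of the 48 elements. *)
Lemma card_SL2F3 : #|SL2F3| = 24.
Proof.
have det_flip x : \det (val (x * flipGL)%g) = - \det (val x).
  have -> : val (x * flipGL)%g = val x *m val flipGL by [].
  by rewrite det_mulmx val_flipGL det_flipmx mulrN1.
have detN1 (x : {'GL_2['F_3]}) : \det (val x) != 1 -> \det (val x) = -1.
  move: (GL_det x); rewrite -[GLval x]/(val x); move: (\det (val x)).
  by apply: F3_ind => //= _ _; apply/eqP.
have im : [set (x * flipGL)%g | x in SL2F3_set]%SET = (~: SL2F3_set)%SET.
  apply/finset.setP=> x; rewrite finset.in_setC inE.
  apply/imsetP/idP => [[y]|/detN1 dx].
    by rewrite inE => /eqP dy ->; rewrite det_flip dy.
  exists (x * flipGL)%g; first by rewrite inE det_flip dx opprK.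
  by rewrite -mulgA flipGL_sq mulg1.
have := cardsC SL2F3_set; rewrite -im card_imset; last exact: mulIg.
have -> : #|{: {'GL_2['F_3]}}| = 48.
  by rewrite -cardsT; have := @card_GL_2 'F_3; rewrite card_Fp.
by rewrite addnn => /(congr1 half); rewrite doubleK.
Qed.

Lemma card_affSL2F3 : #|affSL2F3| = 216.
Proof. by rewrite card_sdprod_by card_SL2F3 cardsT card_mx card_Fp. Qed.

(** * Identities for composition with an involution [t], which will be transposition *)

Lemma comp_lfun_conj (K : fieldType) (V : vectType K) (f g t : 'End(V)) :
  (f \o g = \1 -> t \o t = \1 -> (t \o f) \o (g \o t) = \1)%VF.
Proof.
by move=> fg tt; rewrite comp_lfunA -(comp_lfunA t) fg comp_lfun1r tt.
Qed.

Lemma comp_lfun_invol (K : fieldType) (V : vectType K) (f g t : 'End(V)) :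
  (t \o t = \1 -> f \o t = g -> f = g \o t)%VF.
Proof. by move=> tt <-; rewrite -comp_lfunA tt comp_lfun1r. Qed.

Lemma comp_lfun_swap (K : fieldType) (V : vectType K) (t f f' g : 'End(V)) :
  (t \o t = \1 -> t \o f = f' \o t -> f' \o g = (t \o f) \o (t \o g))%VF.
Proof.
by move=> tt ->; rewrite -comp_lfunA (comp_lfunA t t) tt comp_lfun1l.
Qed.

Lemma comp_lfun_invol_inj (K : fieldType) (V : vectType K) (t f g : 'End(V)) :
  (t \o t = \1 -> t \o f = t \o g -> f = g)%VF.
Proof.
by move=> tt fg; rewrite -[f]comp_lfun1l -[g]comp_lfun1l -tt -!comp_lfunA fg.
Qed.

Local Open Scope classical_set_scope.
Local Open Scope ring_scope.

Lemma card_range_inj (T : finType) (U : Type) (f : T -> U) :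
  injective f -> (range f #= `I_#|T|)%card.
Proof.
move=> finj; have -> : range f = range (f \o @enum_val T T).
  rewrite eqEsubset; split=> [_ [x _ <-]|_ [i _ <-]]; last by exists (enum_val i).
  by exists (enum_rank x); rewrite //= enum_rankK.
apply: (card_eq_trans _ (card_esym card_II)); apply: inj_card_eq.
by move=> i j _ _ /finj /enum_val_inj.
Qed.

(** * The eighteen matrices and their cubes *)

Section Hesse.
Variable R : realType.
Notation C := R[i].
Notation zeta := (zeta R).
Notation alpha := (alpha R).
Notation mats := (mats R).
Notation cubes := (@cubes R).

Lemma zeta_exp n : zeta ^+ n =
  (cos (n%:R * (2 * pi / 3)) +i* sin (n%:R * (2 * pi / 3)))%C.
Proof.
elim: n => [|n IHn]; first by rewrite expr0 mul0r cos0 sin0.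
rewrite exprS IHn /zeta; move: (2 * pi / 3) => t; apply/eqP; rewrite eq_complex /=.
by rewrite -[n.+1%:R]natr1 mulrDl mul1r cosD sinD; apply/andP; split; apply/eqP; ring.
Qed.

(** The order divides 3 by de Moivre's formula, and is not 1 because the imaginary part
    [sin (2 * pi / 3)] is positive. *)
Lemma zeta_prim : 3.-primitive_root zeta.
Proof.
have [|m mz m3] := @prim_order_exists _ 3 zeta isT.
  by rewrite zeta_exp mulrC divfK ?pnatr_eq0 // mulr_natl cos2pi sin2pi.
have [m1|<- //] : m = 1%N \/ m = 3%N.
  by move: m m3 {mz} => [|[|[|[|m]]]] // /dvdn_leq; auto.
move: mz; rewrite m1 => /prim_expr_order; rewrite expr1 => /eqP.
rewrite eq_complex /= => /andP[_]; rewrite gt_eqF // sin_gt0_pi //.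
by have := pi_gt0 R => pi0; apply/andP; split; lra.
Qed.

Lemma alpha_neq0 : alpha != 0.
Proof.
by rewrite /alpha eq_complex /= eqxx andbT oppr_eq0 gt_eqF // powR_gt0.
Qed.

Notation weyl := (weyl zeta).
Notation parity := (parity zeta).

(** Listed in the order of [mats], with the exact phases. *)
Definition weyl_mats : seq 'M[C]_3 :=
  [:: 1%:M - parity (row2 0 1); 1%:M - parity (row2 1 0);
      1%:M - parity (row2 2%:R 2%:R); 1%:M - parity (row2 2%:R 0);
      1%:M - parity (row2 0 2%:R); 1%:M - parity (row2 1 1);
      1%:M - parity (row2 1 2%:R); 1%:M - parity (row2 2%:R 1);
      1%:M - parity (row2 0 0); alpha%:M;
      zeta *: weyl (col2 1 1); zeta *: weyl (col2 2%:R 2%:R);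
      zeta ^+ 2 *: weyl (col2 1 2%:R); weyl (col2 2%:R 0);
      weyl (col2 0 1); zeta ^+ 2 *: weyl (col2 2%:R 1);
      weyl (col2 0 2%:R); weyl (col2 1 0)].

Lemma matsE : mats = weyl_mats.
Proof.
have z2z : zeta ^+ 2 * zeta = 1 by rewrite -exprSr (prim_expr_order zeta_prim).
have zz2 : zeta * zeta ^+ 2 = 1 by rewrite mulrC.
have z2z2 : zeta ^+ 2 * zeta ^+ 2 = zeta by rewrite [in LHS]expr2 mulrA z2z mul1r.
rewrite /mats /weyl_mats /mx3 /=.
do 9![congr (_ :: _);
  [rewrite (parityE zeta_prim); apply/matrixP=> -[[|[|[|//]]] hi] [[|[|[|//]]] hj];
   rewrite !mxE /= /chi /= ?expr0 ?expr1 ?subrr ?subr0 ?sub0r //|]].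
congr (_ :: _).
  by apply/matrixP=> -[[|[|[|//]]] hi] [[|[|[|//]]] hj]; rewrite !mxE.
do 8![congr (_ :: _) => //;
  first by [apply/matrixP=> -[[|[|[|//]]] hi] [[|[|[|//]]] hj];
   rewrite !mxE /weyl_entry !mxE /= /chi /= ?expr0 ?expr1 ?mulr0 ?mulr1 ?z2z ?zz2 ?z2z2]].
Qed.

Lemma symcubeP m n : symcube m = symcube n <->
  forall i j k, mxvec m 0 i * mxvec m 0 j * mxvec m 0 k =
                mxvec n 0 i * mxvec n 0 j * mxvec n 0 k :> C.
Proof.
split=> [/matrixP mn i j k|mn].
  have := mn (mxtens_index (mxtens_index (0, 0), 0))
    (mxtens_index (mxtens_index (i, j), k)).
  by rewrite /symcube !tensmxE.
apply/matrixP=> r c; rewrite /symcube.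
case: (mxtens_indexP r) => r1 r2; case: (mxtens_indexP r1) => r3 r4.
case: (mxtens_indexP c) => c1 c2; case: (mxtens_indexP c1) => c3 c4.
by rewrite !tensmxE !ord1 mn.
Qed.

Lemma symcubeZ k m : symcube (chi zeta k *: m) = symcube m.
Proof.
apply/symcubeP => i j l; rewrite !linearZ !mxE.
transitivity (chi zeta k ^+ 3 * (mxvec m 0 i * mxvec m 0 j * mxvec m 0 l)); first by ring.
by rewrite (chi_cube zeta_prim) mul1r.
Qed.

(** At a nonzero coordinate [i] of [m] the ratio of the two coordinates has cube 1; the products of
    coordinates [i], [i], [j] then carry this ratio to every [j]. *)
Lemma symcube_inj m n : symcube m = symcube n -> exists k, m = chi zeta k *: n.
Proof.
move/symcubeP => mn; have [m0|/rV0Pn[i mi]] := eqVneq (mxvec m) 0.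
  exists 0; rewrite chi0 scale1r; apply: (can_inj mxvecK); rewrite m0.
  apply/rowP=> i; have := mn i i i; rewrite m0 mxE !mul0r -expr2 -exprSr => /esym/eqP.
  by rewrite expf_eq0 => /eqP.
have ni : mxvec n 0 i != 0.
  apply: contraNneq mi => ni; have /eqP := mn i i i.
  by rewrite ni !mulr0 -expr2 -exprSr expf_eq0.
have c3 : (mxvec m 0 i / mxvec n 0 i) ^+ 3 = 1.
  by rewrite expr_div_n !exprSr expr0 !mul1r mn divff // !mulf_neq0.
have [[k hk] /= kE] := prim_rootP zeta_prim c3.
have {kE} mE : mxvec m 0 i = chi zeta (Ordinal hk) * mxvec n 0 i.
  by rewrite -[LHS](divfK ni) kE.
exists (Ordinal hk); apply: (can_inj mxvecK); rewrite linearZ; apply/rowP=> j.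
have := mn i i j; rewrite mxE mE; move: (chi_cube zeta_prim (Ordinal hk)).
move: (chi zeta _) => c c31 /(congr1 ( *%R c)) h.
apply: (mulfI (mulf_neq0 ni ni)).
transitivity (c ^+ 3 * (mxvec n 0 i * mxvec n 0 i * mxvec m 0 j)).
  by rewrite c31 mul1r.
by rewrite [RHS]mulrCA -h; ring.
Qed.

Lemma mats_cases m : m \in mats ->
  [\/ m = alpha%:M, exists v, m = 1%:M - parity v |
      exists k p, p != 0 /\ m = chi zeta k *: weyl p].
Proof.
have w k a b : (a != 0) || (b != 0) -> m = chi zeta k *: weyl (col2 a b) ->
   [\/ m = alpha%:M, exists v, m = 1%:M - parity v |
      exists k p, p != 0 /\ m = chi zeta k *: weyl p].
  by move=> ab mE; constructor 3; exists k, (col2 a b); split=> //; apply: col2_neq0.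
(* Supplies the phase [k = 0] for Weyl operators listed without a scalar. *)
have c0 X : X = chi zeta 0 *: X by rewrite scale1r.
rewrite matsE /weyl_mats !inE.
do 9![case/orP => [/eqP ->|]; first by constructor 2; eexists].
case/orP => [/eqP ->|]; first by constructor 1.
case/orP => [/eqP|]; first exact: (w 1).
case/orP => [/eqP|]; first exact: (w 1).
case/orP => [/eqP|]; first exact: (w 2%:R).
case/orP => [/eqP|]; first by rewrite [X in _ = X]c0; apply: w.
case/orP => [/eqP|]; first by rewrite [X in _ = X]c0; apply: w.
case/orP => [/eqP|]; first exact: (w 2%:R).
case/orP => [/eqP|]; first by rewrite [X in _ = X]c0; apply: w.
by move=> /eqP; rewrite [X in _ = X]c0; apply: w.
Qed.

Lemma mem_mats k : (k < 18)%N -> nth 0 weyl_mats k \in mats.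
Proof. by move=> k18; rewrite -matsE mem_nth. Qed.

Lemma cubes_alpha : cubes (symcube alpha%:M).
Proof. by exists alpha%:M => //=; apply: (@mem_mats 9). Qed.

Lemma cubes_parity v : cubes (symcube (1%:M - parity v)).
Proof.
exists (1%:M - parity v) => //=; rewrite [v]row2E.
(* The pairs come in lexicographic order; each number is the position in [weyl_mats], counted from
   0, of the corresponding matrix. *)
move: (v 0 0) (v 0 1); apply: F3_ind; apply: F3_ind.
- exact: (@mem_mats 8).
- exact: (@mem_mats 0).
- exact: (@mem_mats 4).
- exact: (@mem_mats 1).
- exact: (@mem_mats 5).
- exact: (@mem_mats 6).
- exact: (@mem_mats 3).
- exact: (@mem_mats 7).
- exact: (@mem_mats 2).
Qed.

Lemma cubes_weyl p : p != 0 -> cubes (symcube (weyl p)).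
Proof.
move=> p0; suff [k ?] : exists k, chi zeta k *: weyl p \in mats.
  by rewrite -(symcubeZ k); exists (chi zeta k *: weyl p).
move: p0; rewrite [p]col2E.
move: (p 0 0) (p 1 0); apply: F3_ind; apply: F3_ind => p0.
- by case/eqP: p0; apply/colP=> i; rewrite !mxE; case: ifP.
- by exists 0; rewrite chi0 scale1r; apply: (@mem_mats 14).
- by exists 0; rewrite chi0 scale1r; apply: (@mem_mats 16).
- by exists 0; rewrite chi0 scale1r; apply: (@mem_mats 17).
- by exists 1; apply: (@mem_mats 10).
- by exists 2%:R; apply: (@mem_mats 12).
- by exists 0; rewrite chi0 scale1r; apply: (@mem_mats 13).
- by exists 2%:R; apply: (@mem_mats 15).
- by exists 1; apply: (@mem_mats 11).
Qed.

(** * The stabiliser of the cubes *)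

Notation clifford := (clifford zeta_prim).
Notation tau := (trmx_lfun R).

Lemma clifford_unit M v : clifford M v 1%:M = 1%:M.
Proof.
by rewrite -(weyl0 zeta) clifford_weyl !mulmx0 mxE chi0 scale1r.
Qed.

Lemma tauE X : tau X = X^T. Proof. by rewrite lfunE. Qed.

Lemma tauK : (tau \o tau)%VF = \1%VF.
Proof. by apply/lfunP => X; rewrite comp_lfunE !tauE trmxK id_lfunE. Qed.

Lemma cubes_clifford M v t : \det M = 1 ->
  cubes t -> cubes (tensor3_act (clifford M v) t).
Proof.
move=> dM [m /= + <-]; rewrite tensor3_act_cube.
case/mats_cases=> [->|[w ->]|[k [p [p0 ->]]]].
- by rewrite -scalemx1 linearZ /= clifford_unit scalemx1; apply: cubes_alpha.
- rewrite linearB /= clifford_unit clifford_parity ?det1_unit //.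
  exact: cubes_parity.
rewrite linearZ /= clifford_weyl !symcubeZ; apply: cubes_weyl.
by rewrite unitmx_mul_eq0 // det1_unit.
Qed.

Lemma cubes_tau t : cubes t -> cubes (tensor3_act tau t).
Proof.
move=> [m /= + <-]; rewrite tensor3_act_cube.
case/mats_cases=> [->|[w ->]|[k [p [p0 ->]]]].
- by rewrite tauE tr_scalar_mx; apply: cubes_alpha.
- by rewrite linearB /= !tauE tr_scalar_mx trmx_parity; apply: cubes_parity.
rewrite linearZ /= tauE trmx_weyl symcubeZ; apply: cubes_weyl.
by rewrite unitmx_mul_eq0 //; case/mulmx1_unit: flipmxK.
Qed.

Lemma tensor3_act_comp f g t : cubes t ->
  tensor3_act (f \o g)%VF t = tensor3_act f (tensor3_act g t).
Proof. by case=> m _ <-; rewrite !tensor3_act_cube comp_lfunE. Qed.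

(** A right inverse that also maps cubes to cubes provides the preimages for the reverse
    inclusion. *)
Lemma cubes_stable f g : (f \o g)%VF = \1%VF ->
    (forall t, cubes t -> cubes (tensor3_act f t)) ->
    (forall t, cubes t -> cubes (tensor3_act g t)) ->
  tensor3_act f @` cubes = cubes.
Proof.
move=> fg fS gS; rewrite eqEsubset; split=> [_ [t tS <-]|t tS]; first exact: fS.
exists (tensor3_act g t); first exact: gS.
by rewrite -tensor3_act_comp // fg; case: tS => m _ <-; rewrite tensor3_act_cube id_lfunE.
Qed.

Lemma clifford_inv M v : \det M = 1 ->
  exists N w, \det N = 1 /\ (clifford M v \o clifford N w)%VF = \1%VF.
Proof.
move=> dM; have MU := det1_unit dM; exists (invmx M), (- (v *m invmx M)); split.
  by have := det1 'F_3 2; rewrite -(mulmxV MU) det_mulmx dM mul1r.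
by rewrite clifford_comp mulmxV // subrr clifford1.
Qed.

Lemma Gamma_S_PGL_clifford f :
  Gamma_S R f -> PGL_conj R f -> exists M v, \det M = 1 /\ f = clifford M v.
Proof.
move=> [_ fS] [g gU fE].
have f1 : f 1%:M = 1%:M by rewrite fE mulmx1 mulmxV.
have fM X Y : f (X *m Y) = f X *m f Y by rewrite !fE !mulmxA mulmxKV.
have trf X : \tr (f X) = \tr X by rewrite fE mxtrace_mulC mulmxA mulVmx ?mul1mx.
have fW p : p != 0 -> exists k q, f (weyl p) = chi zeta k *: weyl q.
  move=> p0; have : cubes (tensor3_act f (symcube (weyl p))).
    by rewrite -fS; exists (symcube (weyl p)) => //; apply: cubes_weyl.
  rewrite tensor3_act_cube => -[m /= mS /esym/symcube_inj[k fp]].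
  (* Conjugation preserves the trace, so [m] is traceless. This excludes the scalar matrix, of trace
     three times [alpha], and the matrices [1%:M - parity w], of trace 2. *)
  have trm : \tr m = 0.
    have := trf (weyl p); rewrite fp mxtraceZ (mxtrace_weyl zeta_prim) (negPf p0).
    by move/eqP; rewrite mulf_eq0 (negPf (chi_neq0 zeta_prim _)) => /eqP.
  case/mats_cases: mS fp trm => [->|[w ->]|[l [q [_ ->]]]] fp.
  - by rewrite mxtrace_scalar => /eqP; rewrite mulrn_eq0 /= (negPf alpha_neq0).
  - rewrite linearB /= mxtrace1 (mxtrace_parity zeta_prim) => /eqP.
    by rewrite subr_eq0 -[1]/(1%:R) eqr_nat.
  move=> _; exists (k + l), q.
  by rewrite fp scalerA (chiD zeta_prim).
have [k [u fu]] := fW _ (@col2_neq0 1 0 isT).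
have [l [w fw]] := fW _ (@col2_neq0 0 1 isT).
exact: (clifford_of_generators zeta_prim f1 fM fu fw).
Qed.

Lemma clifford_PGL M v : \det M = 1 -> PGL_conj R (clifford M v).
Proof.
move=> dM; have [||g gU gE] := @Skolem_Noether_matrix _ _ (clifford M v).
- exact: clifford_unit.
- by move=> X Y; rewrite clifford_mulmx.
by exists g.
Qed.

Lemma clifford_Gamma_S M v : \det M = 1 -> Gamma_S R (clifford M v).
Proof.
move=> dM; split; first by left; apply: clifford_PGL.
have [N [w [dN MN]]] := clifford_inv v dM.
by apply: (cubes_stable MN) => t; apply: cubes_clifford.
Qed.

Lemma tau_clifford M v :
  (tau \o clifford M v)%VF =
  (clifford (flipmx *m M *m flipmx) (v *m flipmx) \o tau)%VF.
Proof.
have FF (p : 'cV_2) : flipmx *m (flipmx *m p) = p by rewrite mulmxA flipmxK mul1mx.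
have L p : (tau \o clifford M v)%VF (weyl p) =
    chi zeta ((v *m p) 0 0) *: weyl (flipmx *m (M *m p)).
  by rewrite comp_lfunE clifford_weyl tauE [LHS]linearZ /= trmx_weyl.
have L' p : (clifford (flipmx *m M *m flipmx) (v *m flipmx) \o tau)%VF (weyl p) =
    chi zeta ((v *m p) 0 0) *: weyl (flipmx *m (M *m p)).
  by rewrite comp_lfunE tauE trmx_weyl clifford_weyl -!mulmxA FF.
by apply/lfunP; apply: (weyl_ext zeta_prim) => p; exact: etrans (L p) (esym (L' p)).
Qed.

Lemma tau_clifford_Gamma_S M v : \det M = 1 -> Gamma_S R (tau \o clifford M v)%VF.
Proof.
move=> dM; have dM' := det_flip_conj dM.
have [N [w [dN MN]]] := clifford_inv v dM; split.
  rewrite tau_clifford; right.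
  have [g gU gE] := clifford_PGL (v *m flipmx) dM'.
  by exists g => // X; rewrite comp_lfunE tauE gE.
apply: (@cubes_stable _ (clifford N w \o tau)%VF).
- exact: comp_lfun_conj MN tauK.
- move=> t tS; rewrite tensor3_act_comp //.
  by apply: cubes_tau; apply: cubes_clifford.
move=> t tS; rewrite tensor3_act_comp //.
by apply: cubes_clifford => //; apply: cubes_tau.
Qed.

(** If [f] involves a transposition, then [f \o tau] is a conjugation that still preserves the
    cubes, hence a Clifford map; [tau_clifford] then moves [tau] to the left. *)
Lemma Gamma_S_cases f : Gamma_S R f -> exists M v, \det M = 1 /\
  (f = clifford M v \/ f = (tau \o clifford M v)%VF).
Proof.
move=> fS; have [[fP|[g gU fE]] fc] := fS.
  have [M [v [dM ->]]] := Gamma_S_PGL_clifford fS fP.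
  by exists M, v; split=> //; left.
have hP : PGL_conj R (f \o tau)%VF.
  by exists g => // X; rewrite comp_lfunE tauE fE trmxK.
have hS : Gamma_S R (f \o tau)%VF.
  split; first by left.
  rewrite -[RHS]fc eqEsubset; split=> [_ [t tS <-]|_ [t tS <-]].
    by exists (tensor3_act tau t); rewrite ?tensor3_act_comp //; apply: cubes_tau.
  exists (tensor3_act tau t); first exact: cubes_tau.
  rewrite -tensor3_act_comp; last exact: tS.
  case: tS => m _ <-.
  by rewrite !tensor3_act_cube !comp_lfunE !tauE trmxK.
have [M [v [dM fME]]] := Gamma_S_PGL_clifford hS hP.
exists (flipmx *m M *m flipmx), (v *m flipmx); split; first exact: det_flip_conj.
right; rewrite tau_clifford -!mulmxA flipmxK !mulmx1 !mulmxA flipmxK mul1mx.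
exact: comp_lfun_invol tauK fME.
Qed.

(** If both were conjugations, comparing the orders of multiplication would give
    [f (X *m Y) = f (Y *m X)], so all matrices would commute; two elementary matrices do not. *)
Lemma tau_notin_PGL f : PGL_conj R f -> ~ PGL_conj R (tau \o f)%VF.
Proof.
move=> [g gU fE] [h hU tfE].
have tfZ Z : (f Z)^T = h *m Z *m invmx h by rewrite -tfE comp_lfunE tauE.
have finj : injective f.
  move=> A B; rewrite !fE => /(congr1 (fun Z => invmx g *m Z *m g)).
  by rewrite !mulmxA !(mulVmx gU) !mul1mx !(mulmxKV gU).
pose X : 'M[C]_3 := delta_mx 0 1; pose Y : 'M[C]_3 := delta_mx 1 0.
have : f (X *m Y) = f (Y *m X).
  apply: trmx_inj; rewrite tfZ.
  transitivity ((f X)^T *m (f Y)^T); first by rewrite !tfZ !mulmxA mulmxKV.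
  by rewrite -trmx_mul !fE !mulmxA mulmxKV.
move/finj; rewrite !mul_delta_mx => /matrixP/(_ 0 0)/eqP.
by rewrite !mxE /= oner_eq0.
Qed.

Lemma clifford_inj M v M' v' :
  clifford M v = clifford M' v' -> M = M' /\ v = v'.
Proof.
move=> cc.
have eqs (p : 'cV_2) : M *m p = M' *m p /\ (v *m p) 0 0 = (v' *m p) 0 0.
  have cp : clifford M v (weyl p) = clifford M' v' (weyl p) by rewrite cc.
  have := etrans (esym (clifford_weyl _ M v p)) (etrans cp (clifford_weyl _ M' v' p)).
  case/(weyl_inj zeta_prim) => [|-> h]; first exact: (chi_neq0 zeta_prim).
  split; first exact: erefl.
  exact: (chi_inj zeta_prim) h.
(* Basis vectors [delta_mx j 0] read off the columns of the matrices and the entries of the row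
   vectors. *)
split.
  apply/row_matrixP => i; apply/rowP => j.
  by have [/colP/(_ i)] := eqs (delta_mx j 0); rewrite -!colE !mxE.
by apply/rowP=> j; have [_] := eqs (delta_mx j 0); rewrite -!colE !mxE.
Qed.

(** * The isomorphism from the abstract semidirect product onto the stabiliser *)

Definition aff_op (x : affSL2F3) : 'End('M[C]_3) := clifford (aff_mx x) (aff_vec x).

Lemma aff_opM x y : aff_op (x * y)%g = (aff_op x \o aff_op y)%VF.
Proof. by rewrite /aff_op clifford_comp aff_mxM aff_vecM. Qed.

Lemma aff_op_inj : injective aff_op.
Proof. by move=> x y /clifford_inj[]; apply: aff_inj. Qed.

Lemma tau_aff_op x : (tau \o aff_op x)%VF = (aff_op (flip_aff x) \o tau)%VF.
Proof. by rewrite /aff_op tau_clifford flip_aff_mx flip_aff_vec. Qed.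

(** The power of [tau] stands on the left because [theta] is a right action: moving a later [tau]
    leftwards past [aff_op x] turns [x] into [flip_aff x]. *)
Definition realization (u : sdprod_by theta) : 'End('M[C]_3) :=
  if u.1 == 0 then aff_op u.2 else (tau \o aff_op u.2)%VF.

Lemma realizationM u v : realization (u * v)%g = (realization u \o realization v)%VF.
Proof.
have fstM : (u * v)%g.1 = u.1 + v.1 by [].
have sndM : (u * v)%g.2 = (flip_act u.2 v.1 * v.2)%g by [].
rewrite /realization fstM sndM; move: (u.1) (v.1) => a b.
have z11 : 1 + 1 = 0 :> 'Z_2 by apply: val_inj.
move: a b; apply: Z2_ind; apply: Z2_ind; rewrite ?addr0 ?add0r ?z11 ?eqxx.
- exact: aff_opM.
- rewrite /flip_act /= aff_opM comp_lfunA.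
  by rewrite tau_aff_op flip_affK -comp_lfunA.
- by rewrite /flip_act /= aff_opM comp_lfunA.
rewrite /flip_act /= aff_opM.
exact: comp_lfun_swap tauK (tau_aff_op _).
Qed.

Lemma aff_op_PGL x : PGL_conj R (aff_op x).
Proof. exact: clifford_PGL (det_aff_mx x). Qed.

(** By [tau_notin_PGL] the maps with and without transposition are disjoint; within each class
    injectivity is that of [aff_op]. *)
Lemma realization_inj : injective realization.
Proof.
have tau_op x y : aff_op x = (tau \o aff_op y)%VF -> False.
  by move=> xy; apply: (tau_notin_PGL (aff_op_PGL y)); rewrite -xy; apply: aff_op_PGL.
move=> u v uv; suff: (u.1, u.2) = (v.1, v.2) by rewrite -!surjective_pairing => /val_inj.
move: uv; rewrite /realization; move: (u.1) (v.1) (u.2) (v.2) => a b x y.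
move: a b; apply: Z2_ind; apply: Z2_ind; rewrite ?eqxx /=.
- by move/aff_op_inj ->.
- by move/tau_op.
- by move/esym/tau_op.
move=> h; suff /aff_op_inj -> : aff_op x = aff_op y by [].
exact: comp_lfun_invol_inj tauK h.
Qed.

Lemma realization_sdpair1 x : realization (sdpair1 theta x) = aff_op x.
Proof.
rewrite /realization; have -> : pair_of_sd (sdpair1 theta x) = (1%g, x) => //.
(* [sdpair1] is built with a default value for pairs outside the product set, so membership has to
   be checked before its components can be read. *)
by rewrite -[LHS]/(val _) val_insubd inE group1 finset.in_setT.
Qed.

Lemma realization_sdpair2 : realization (sdpair2 theta (1%R : 'Z_2)) = tau.
Proof.
rewrite /realization.
have -> : pair_of_sd (sdpair2 theta (1%R : 'Z_2)) = (1, 1%g).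
  rewrite -[LHS]/(val _) val_insubd ifT //.
  by apply/finset.setXP; rewrite !finset.in_setT.
have aff1 : aff_op 1%g = \1%VF by exact: clifford1.
by rewrite /= aff1 comp_lfun1r.
Qed.

Lemma realization_surj (k : 'Z_2) (x : affSL2F3) : exists u, realization u =
  if k == 0 then aff_op x else (tau \o aff_op x)%VF.
Proof.
have kx : (k, x) \in finset.setX [set: 'Z_2]%G [set: affSL2F3]%G.
  by apply/finset.setXP; rewrite !finset.in_setT.
by exists (SdPair theta kx).
Qed.

Lemma range_realization : range realization = Gamma_S R.
Proof.
rewrite eqEsubset; split=> [_ [u _ <-]|f].
  rewrite /realization; case: ifP => _.
    exact: clifford_Gamma_S (det_aff_mx _).
  exact: tau_clifford_Gamma_S (det_aff_mx _).
case/Gamma_S_cases=> M [v [dM fE]].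
have [x [xM xv]] := aff_exists v dM.
have fE' : f = aff_op x \/ f = (tau \o aff_op x)%VF by rewrite /aff_op xM xv.
case: fE' => ->.
  by have [u uE] := realization_surj 0 x; exists u => //; rewrite uE eqxx.
by have [u uE] := realization_surj 1 x; exists u => //; rewrite uE oner_eq0.
Qed.

Lemma range_realization_sdpair1 :
  range (realization \o sdpair1 theta) = Gamma_S R `&` PGL_conj R.
Proof.
rewrite eqEsubset; split=> [_ [x _ <-]|f [fS fP]].
  rewrite /comp realization_sdpair1; split; last exact: aff_op_PGL.
  exact: clifford_Gamma_S (det_aff_mx _).
have [M [v [dM ->]]] := Gamma_S_PGL_clifford fS fP.
have [x [xM xv]] := aff_exists v dM; exists x => //.
by rewrite /comp realization_sdpair1 /aff_op xM xv.
Qed.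

Lemma card_Gamma_S : (Gamma_S R #= `I_432)%card.
Proof.
rewrite -range_realization.
have := card_range_inj realization_inj.
by rewrite card_sdprod_by !cardsT card_affSL2F3 card_ord.
Qed.

End Hesse.

Theorem theorem2 (R : realType) :
  (exists (theta : groupAction [set: 'Z_2]%G [set: affSL2F3]%G)
          (phi : sdprod_by theta -> 'End('M[R[i]]_3)),
     [/\ (forall x y, phi (x * y)%g = (phi x \o phi y)%VF),
         injective phi,
         range phi = Gamma_S R,
         range (phi \o sdpair1 theta) = Gamma_S R `&` PGL_conj R
       & phi (sdpair2 theta (1%R : 'Z_2)) = trmx_lfun R]) /\
  (Gamma_S R #= `I_432)%card.
Proof.
split; last exact: card_Gamma_S.
exists theta, (@realization R); split.
- exact: realizationM.
- exact: realization_inj.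
- exact: range_realization.
- exact: range_realization_sdpair1.
- exact: realization_sdpair2.
Qed.
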